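(* Let $k$ be a field of characteristic different from $2,3$, and let $H_i,\widetilde{H}_i$ ($i=1,\dots,4$) and $\Delta$ be the polynomials over $k(r,s,t)$ defined in the context. Then, in $k(r,s,t)[x,\tilde x]$, $$H_1(x)\widetilde{H}_1(\tilde x)+H_2(x)\widetilde{H}_2(\tilde x)+H_3(x)\widetilde{H}_3(\tilde x)+H_4(x)\widetilde{H}_4(\tilde x)=\Delta(x-\tilde x)^2.$$
   Context: Polynomials: $H_1=x^2+rx+t$, $H_2=x^2+x+r$, $H_3=sx^2+(2sr-st-1)x+sr^2$, $H_4=(str-st-sr^2+sr+r)x^2+(st^2-str-st-sr^3+2sr^2+t)x+st^2-str^2-str+sr^3+t$. Write $H_j(x)=h_{2j}x^2+h_{1j}x+h_{0j}$. Let $\delta_3=st+1$, $\delta_5=r^3s-3rst+st^2+st+t$, and $$A=\begin{pmatrix} h_{21} & h_{22} & h_{23} & h_{24} \\ h_{11} & h_{12} & h_{13} & h_{14} \\ h_{01} & h_{02} & h_{03} & h_{04} \\ -\frac r2 & -\frac12 & -\frac{\delta_3}2 & -\frac{\delta_5}2 \end{pmatrix}.$$ Then $$\begin{aligned} \Delta={}&r^6s^2-6r^4s^2t-3r^4s+2r^3s^2t^2+2r^3s^2t+3r^3st+r^3s+r^3+9r^2s^2t^2+6r^2st\\ &-6rs^2t^3-6rs^2t^2-9rst^2-3rst-3rt+s^2t^4+2s^2t^3+s^2t^2+2st^3+3st^2+t^2+t, \end{aligned}$$ which equals $\det(A)$. Let $M$ be the cofactor matrix of $A$ ($M^T=\det(A)A^{-1}$)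 with entries $M_{ij}$, and define $\widetilde{H}_j(x)=M_{3j}x^2-2M_{2j}x+M_{1j}$ for $j=1,\dots,4$. *)

(* Defs.v *)
From mathcomp Require Import all_boot all_algebra.
From mathcomp Require Export mpoly.
Set Implicit Arguments.
Unset Strict Implicit.
Unset Printing Implicit Defensive.
Import GRing.Theory.
Local Open Scope ring_scope.

(* k(r,s,t), with r, s, t the images of the variables 0, 1, 2 *)
Definition ratfun3 (k : fieldType) : fieldType := {fraction {mpoly k[3]}}.
Definition ratfun3_var (k : fieldType) (i : 'I_3) : ratfun3 k :=
  tofrac ('X_i : {mpoly k[3]}).

Definition H1 (F : fieldType) (r s t : F) : {poly F} :=
  'X^2 + r *: 'X + t%:P.
Definition H2 (F : fieldType) (r s t : F) : {poly F} :=
  'X^2 + 'X + r%:P.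
Definition H3 (F : fieldType) (r s t : F) : {poly F} :=
  s *: 'X^2 + (2 * s * r - s * t - 1) *: 'X + (s * r ^+ 2)%:P.
Definition H4 (F : fieldType) (r s t : F) : {poly F} :=
  (s * t * r - s * t - s * r ^+ 2 + s * r + r) *: 'X^2
  + (s * t ^+ 2 - s * t * r - s * t - s * r ^+ 3 + 2 * s * r ^+ 2 + t) *: 'X
  + (s * t ^+ 2 - s * t * r ^+ 2 - s * t * r + s * r ^+ 3 + t)%:P.

(* Families and matrices are indexed from 0: the index j : 'I_4 stands for
   j + 1 in the usual numbering 1, ..., 4. *)
Definition H (F : fieldType) (r s t : F) (j : 'I_4) : {poly F} :=
  [:: H1 r s t; H2 r s t; H3 r s t; H4 r s t]`_j.

Definition delta3 (F : fieldType) (r s t : F) : F := s * t + 1.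
Definition delta5 (F : fieldType) (r s t : F) : F :=
  r ^+ 3 * s - 3 * r * s * t + s * t ^+ 2 + s * t + t.

Definition A (F : fieldType) (r s t : F) : 'M[F]_4 :=
  \matrix_(i < 4, j < 4)
    [:: (H r s t j)`_2;
        (H r s t j)`_1;
        (H r s t j)`_0;
        [:: - (r / 2); - (1 / 2);
            - (delta3 r s t / 2); - (delta5 r s t / 2)]`_j]`_i.

Definition M (F : fieldType) (r s t : F) : 'M[F]_4 :=
  \matrix_(i < 4, j < 4) cofactor (A r s t) i j.

Definition Htilde (F : fieldType) (r s t : F) (j : 'I_4) : {poly F} :=
  M r s t (inord 2) j *: 'X^2 - (2 * M r s t (inord 1) j) *: 'X
  + (M r s t (inord 0) j)%:P.

Definition Delta (F : fieldType) (r s t : F) : F :=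
  r ^+ 6 * s ^+ 2 - 6 * r ^+ 4 * s ^+ 2 * t - 3 * r ^+ 4 * s
  + 2 * r ^+ 3 * s ^+ 2 * t ^+ 2 + 2 * r ^+ 3 * s ^+ 2 * t
  + 3 * r ^+ 3 * s * t + r ^+ 3 * s + r ^+ 3
  + 9 * r ^+ 2 * s ^+ 2 * t ^+ 2 + 6 * r ^+ 2 * s * t
  - 6 * r * s ^+ 2 * t ^+ 3 - 6 * r * s ^+ 2 * t ^+ 2
  - 9 * r * s * t ^+ 2 - 3 * r * s * t - 3 * r * t
  + s ^+ 2 * t ^+ 4 + 2 * s ^+ 2 * t ^+ 3 + s ^+ 2 * t ^+ 2
  + 2 * s * t ^+ 3 + 3 * s * t ^+ 2 + t ^+ 2 + t.

(* Main.v *)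
(* The rows 1, 2, 3 of A hold the coefficients of the H_j, while the coefficients
   of the Htilde_j are cofactors of the same rows. By Laplace expansion rows i of
   A and i' of M have scalar product (det A) [i = i'], so only the
   products x^2 * 1, x * (-2 xt) and 1 * xt^2 survive, each with the factor
   det A = Delta. *)
Require Import Defs.
From mathcomp Require Import all_boot all_algebra ring.
Import GRing.Theory.
Local Open Scope ring_scope.

(** Entrywise form of [B *m \adj B = (\det B)%:M]. *)
Lemma sum_mul_cofactor (R : comNzRingType) (n : nat) (B : 'M[R]_n) (i i' : 'I_n) :
  \sum_j B i j * cofactor B i' j = \det B *+ (i == i').
Proof.
have /matrixP/(_ i i') := mul_mx_adj B.
by rewrite !mxE => <-; apply: eq_bigr => j _; rewrite !mxE.
Qed.

(** Selects the coefficient rows; the last row of [A] enters only through cofactors and the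
    determinant. *)
Definition coef_row : 'I_3 -> 'I_4 := widen_ord (isT : 3 <= 4)%N.

Lemma horner_alg_deg2 (F : fieldType) (R : comAlgType F) (u : R) (a b c : F) :
  horner_alg u (a *: 'X^2 + b *: 'X + c%:P) = a *: u ^+ 2 + b *: u + c%:A.
Proof.
rewrite -!mul_polyC !rmorphD !rmorphM /= !horner_algX !horner_algC expr2.
by rewrite !mulr_algl.
Qed.

Lemma horner_alg_H (F : fieldType) (R : comAlgType F) (r s t : F) (x : R) j :
  horner_alg x (H r s t j)
    = \sum_(i < 3) A r s t (coef_row i) j *: [:: x ^+ 2; x; 1]`_i.
Proof.
have -> : H r s t j = (H r s t j)`_2 *: 'X^2 + (H r s t j)`_1 *: 'X
                      + ((H r s t j)`_0)%:P.
  by case: j => [[|[|[|[|//]]]] lt_j]; rewrite /H /= ?/H1 ?/H2 ?/H3 ?/H4 !coefE /=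
    ?(mulr0, mulr1, addr0, add0r, scale1r).
by rewrite horner_alg_deg2 !big_ord_recl big_ord0 !mxE /= addr0 addrA.
Qed.

(** The powers run opposite to those for [H]: row 0 goes with [1] and row 2 with [x ^+ 2], so that
    entries of equal index multiply to the terms of a squared difference. *)
Lemma horner_alg_Htilde (F : fieldType) (R : comAlgType F) (r s t : F) (x : R) j :
  horner_alg x (Htilde r s t j)
    = \sum_(i < 3) cofactor (A r s t) (coef_row i) j
        *: [:: 1; - (x *+ 2); x ^+ 2]`_i.
Proof.
rewrite /Htilde -scaleNr horner_alg_deg2 !big_ord_recl big_ord0 /= addr0.
rewrite ![M _ _ _ _ _]mxE [LHS]addrC [X in _ + X = _]addrC.
have rowE (i : 'I_3) : inord i = coef_row i.
  by apply: val_inj; rewrite /= inordK // ltnS ltnW.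
have -> (b : F) : - (2 * b) *: x = b *: - (x *+ 2).
  by rewrite scaleNr scalerN -scalerA scaler_nat scalerMnr.
by rewrite -(rowE ord0) -(rowE (lift _ _)) -(rowE (lift _ (lift _ _))).
Qed.

Lemma det_A (F : fieldType) (r s t : F) :
  (2 : F) != 0 -> \det (A r s t) = Delta r s t.
Proof.
(* Repeated row expansion reaches 1 by 1 minors; [nz2] then lets [field] clear the halves in the
   last row. *)
move=> nz2; rewrite (expand_det_row _ ord0) !big_ord_recl big_ord0.
rewrite /cofactor !(expand_det_row _ ord0) !big_ord_recl !big_ord0 /cofactor.
rewrite !(expand_det_row _ ord0) !big_ord_recl !big_ord0 /cofactor !det_mx11.
rewrite !mxE /= /bump /= /H /= /H1 /H2 /H3 /H4 !coefE /= /delta3 /delta5 /Delta.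
by field.
Qed.

(** An arbitrary commutative algebra [R] allows [x] and [xt] to become two independent
    indeterminates. *)
Lemma sum_H_Htilde (F : fieldType) (R : comAlgType F) (r s t : F) (x xt : R) :
  (2 : F) != 0 ->
  \sum_(j < 4) horner_alg x (H r s t j) * horner_alg xt (Htilde r s t j)
    = Delta r s t *: (x - xt) ^+ 2.
Proof.
move=> nz2; under eq_bigr => j _ do
  rewrite horner_alg_H horner_alg_Htilde big_distrlr /=.
rewrite exchange_big /=.
(* Only the diagonal [i = i'] of the double sum over rows is kept here. *)
transitivity (\sum_(i < 3) Delta r s t
    *: ([:: x ^+ 2; x; 1]`_i * [:: 1; - (xt *+ 2); xt ^+ 2]`_i)); last first.
  by rewrite -scaler_sumr !big_ord_recl big_ord0 /=; congr (_ *: _); ring.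
apply: eq_bigr => i _; rewrite exchange_big /=.
rewrite (eq_bigr (fun i' => (\det (A r s t) *+ (i == i'))
    *: ([:: x ^+ 2; x; 1]`_i * [:: 1; - (xt *+ 2); xt ^+ 2]`_i'))) => [|i' _].
  rewrite (bigD1 i) //= eqxx det_A // big1 ?addr0 // => i' ne_i'i.
  by rewrite eq_sym (negPf ne_i'i) scale0r.
under eq_bigr => j _ do rewrite -scalerAl -scalerAr scalerA.
(* [coef_row] preserves values, so equality of rows in ['I_4] is equality of indices in ['I_3]. *)
by rewrite -scaler_suml sum_mul_cofactor -val_eqE.
Qed.

Theorem corollary14 (k : fieldType)
    (hk2 : 2%N \notin [pchar k]) (hk3 : 3%N \notin [pchar k]) :
  let r : ratfun3 k := ratfun3_var k 0 in
  let s : ratfun3 k := ratfun3_var k 1 in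
  let t : ratfun3 k := ratfun3_var k 2 in
  let x : {mpoly (ratfun3 k)[2]} := 'X_0 in
  let xt : {mpoly (ratfun3 k)[2]} := 'X_1 in
  \sum_(j < 4) horner_alg x (H r s t j) * horner_alg xt (Htilde r s t j)
    = (Delta r s t)%:MP * (x - xt) ^+ 2.
Proof.
move=> r s t x xt; rewrite mul_mpolyC; apply: sum_H_Htilde.
have nz2 : (2 : k) != 0 by move: hk2; rewrite inE.
(* Constants embed injectively into polynomials, and these into fractions, so 2 stays nonzero. *)
have -> : (2 : ratfun3 k) = tofrac (2 : k)%:MP by rewrite !rmorph_nat.
by rewrite tofrac_eq0 mpolyC_eq0.
Qed.
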